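(* Let $C^s\in\mathbb{R}^{p\times n}$, $\xi^s\in\mathbb{R}^p$, $C^t\in\mathbb{R}^{q\times n}$, $\xi^t\in\mathbb{R}^q$ with $p,q\ge1$, let $x\in\mathbb{R}^n$, $X$ a symmetric $n\times n$ matrix, and $\beta_{st}\in\mathbb{R}$ (the linearization of $l_s(x,z)l_t(x,z)$). For $i=1,\dots,p$ put $$H^i=C^tX(C^s_{i,\cdot})^T+\xi^s_iC^tx+(C^s_{i,\cdot}x)\xi^t+\xi^s_i\xi^t\in\mathbb{R}^q.$$ Then the SST constraint $$\left\|C^sX(C^t)^T+C^sx(\xi^t)^T+\xi^sx^T(C^t)^T+\xi^s(\xi^t)^T\right\|_F\le\beta_{st}$$ is equivalent to the linear matrix inequality $$\begin{pmatrix}\beta_{st}I_q&&&H^1\\ &\ddots&&\vdots\\ &&\beta_{st}I_q&H^p\\ (H^1)^T&\cdots&(H^p)^T&\beta_{st}\end{pmatrix}\succeq0$$ (with $p$ diagonal blocks $\beta_{st}I_q$ and zero off-diagonal blocks among them), whose left-hand side is a submatrix of the linearized Kronecker (Tracy-Singh) product of $\begin{pmatrix}l_s(x,z)I_p&h^s(x)\\ h^s(x)^T&l_s(x,z)\end{pmatrix}$ and $\begin{pmatrix}l_t(x,z)I_q&h^t(x)\\ h^t(x)^T&l_t(x,z)\end{pmatrix}$.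
   Context: Here $\|C^sx+\xi^s\|\le l_s(x,z)$ and $\|C^tx+\xi^t\|\le l_t(x,z)$ are two second order cone constraints with $l_r(x,z)=(\zeta^r)^Tx+(\eta^r)^Tz+\theta^r$ affine in $(x,z)$, and $h^r(x)=C^rx+\xi^r$, $r=s,t$. Linearization means replacing $xx^T$ by $X$, $xz^T$ by $S$, $zz^T$ by $Z$ in quadratic expressions, so $$\beta_{st}=(\zeta^s)^TX\zeta^t+(\zeta^s)^TS\eta^t+(\zeta^t)^TS\eta^s+(\eta^s)^TZ\eta^t+(\theta^s\zeta^t+\theta^t\zeta^s)^Tx+(\theta^s\eta^t+\theta^t\eta^s)^Tz+\theta^s\theta^t.$$ $C^s_{i,\cdot}$ is the $i$-th row of $C^s$, $\|\cdot\|_F$ the Frobenius norm. The Tracy-Singh product is a permutation of the Kronecker product, whose blocks are the Kronecker products of the blocks of the two factors. *)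

(* Defs.v *)
From HB Require Import structures.
From mathcomp Require Import all_boot all_order all_algebra.
From mathcomp Require Import reals.
From mathcomp Require Import mpoly mxtens.

Set Implicit Arguments.
Unset Strict Implicit.
Unset Printing Implicit Defensive.

Import Order.TTheory GRing.Theory Num.Theory.
Local Open Scope ring_scope.

Definition frobenius_norm (R : rcfType) (m n : nat) (A : 'M[R]_(m, n)) : R :=
  Num.sqrt (\sum_i \sum_j A i j ^+ 2).

Definition psdmx (R : realFieldType) (n : nat) (A : 'M[R]_n) : Prop :=
  A^T = A /\ forall v : 'cV[R]_n, 0 <= (v^T *m A *m v) 0 0.

Definition is_submatrix (R : Type) (m n m' n' : nat)
    (A : 'M[R]_(m, n)) (B : 'M[R]_(m', n')) : Prop :=
  exists (f : 'I_m -> 'I_m') (g : 'I_n -> 'I_n'),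
    [/\ {homo f : i j / (i < j)%N}, {homo g : i j / (i < j)%N}
      & A = mxsub f g B].

(* The Tracy-Singh product of two 2 x 2 block matrices: the (i, j)-th block of
   the product is itself partitioned, its (k, l)-th block being the Kronecker
   product of the (i, j)-th block of A and the (k, l)-th block of B. *)
Definition tens_blocks (R : pzRingType) (m n p1 p2 q1 q2 : nat)
    (A : 'M[R]_(m, n)) (B : 'M[R]_(p1 + p2, q1 + q2)) :
    'M[R]_(m * p1 + m * p2, n * q1 + n * q2) :=
  block_mx (A *t ulsubmx B) (A *t ursubmx B)
           (A *t dlsubmx B) (A *t drsubmx B).

Definition tracy_singh (R : pzRingType) (m1 m2 n1 n2 p1 p2 q1 q2 : nat)
    (A : 'M[R]_(m1 + m2, n1 + n2)) (B : 'M[R]_(p1 + p2, q1 + q2)) :=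
  block_mx (tens_blocks (ulsubmx A) B) (tens_blocks (ursubmx A) B)
           (tens_blocks (dlsubmx A) B) (tens_blocks (drsubmx A) B).

Section Linearization.
Variables (R : realType) (n m : nat).

(* Linearization of a polynomial of degree at most 2 in (x, z), as a linear map
   on its coefficients: x_i x_j, x_i z_j, z_i z_j are replaced by X_ij, S_ij,
   Z_ij, for X and Z symmetric.  The first n variables are x, the last m are z,
   each quadratic monomial is counted once (i <= j), and monomials of degree
   greater than 2 are discarded: it is meant for quadratic arguments only. *)
Definition linearize (x : 'cV[R]_n) (z : 'cV[R]_m)
    (X : 'M[R]_n) (S : 'M[R]_(n, m)) (Z : 'M[R]_m)
    (P : {mpoly R[n + m]}) : R :=
  let w := col_mx x z in
  let W := block_mx X S S^T Z in
  P@_0%MM + \sum_(i < n + m) P@_U_(i) * w i 0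
  + \sum_(i < n + m) \sum_(j < n + m | (i <= j)%N) P@_(U_(i) + U_(j)) * W i j.

Definition xpoly : 'cV[{mpoly R[n + m]}]_n := \col_i 'X_(lshift m i).
Definition zpoly : 'cV[{mpoly R[n + m]}]_m := \col_i 'X_(rshift n i).

Definition mxC (k l : nat) (A : 'M[R]_(k, l)) : 'M[{mpoly R[n + m]}]_(k, l) :=
  map_mx (@mpolyC (n + m) R) A.

Definition lpoly (zeta : 'cV[R]_n) (eta : 'cV[R]_m) (theta : R) :
    {mpoly R[n + m]} :=
  ((mxC zeta)^T *m xpoly) 0 0 + ((mxC eta)^T *m zpoly) 0 0 + theta%:MP.

Definition hpoly (p : nat) (C : 'M[R]_(p, n)) (xi : 'cV[R]_p) :
    'cV[{mpoly R[n + m]}]_p :=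
  mxC C *m xpoly + mxC xi.

Definition soc_mx (p : nat) (l : {mpoly R[n + m]})
    (h : 'cV[{mpoly R[n + m]}]_p) : 'M[{mpoly R[n + m]}]_(p + 1) :=
  block_mx l%:M h h^T l%:M.

Definition beta_lin (zetas zetat : 'cV[R]_n) (etas etat : 'cV[R]_m)
    (thetas thetat : R) (x : 'cV[R]_n) (z : 'cV[R]_m)
    (X : 'M[R]_n) (S : 'M[R]_(n, m)) (Z : 'M[R]_m) : R :=
  (zetas^T *m X *m zetat + zetas^T *m S *m etat + zetat^T *m S *m etas
   + etas^T *m Z *m etat
   + (thetas *: zetat + thetat *: zetas)^T *m x
   + (thetas *: etat + thetat *: etas)^T *m z) 0 0
  + thetas * thetat.

End Linearization.

Definition Hvec (R : pzRingType) (n p q : nat)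
    (Cs : 'M[R]_(p, n)) (xis : 'cV[R]_p) (Ct : 'M[R]_(q, n)) (xit : 'cV[R]_q)
    (x : 'cV[R]_n) (X : 'M[R]_n) (i : 'I_p) : 'cV[R]_q :=
  Ct *m X *m (row i Cs)^T + xis i 0 *: (Ct *m x)
  + (row i Cs *m x) 0 0 *: xit + xis i 0 *: xit.

Definition lmi_mx (R : pzRingType) (p q : nat) (beta : R)
    (H : 'I_p -> 'cV[R]_q) : 'M[R]_(\sum_(i < p) q + 1) :=
  block_mx (\mxdiag_(i < p) (beta%:M : 'M[R]_q)) (\mxcol_(i < p) H i)
           (\mxrow_(i < p) (H i)^T)              beta%:M.

(* Main.v *)
Require Import Defs.
From HB Require Import structures.
From mathcomp Require Import all_boot all_order all_algebra.
From mathcomp Require Import reals.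
From mathcomp Require Import mpoly mxtens.
From mathcomp Require Import ring lra.

Set Implicit Arguments.
Unset Strict Implicit.
Unset Printing Implicit Defensive.

Import Order.TTheory GRing.Theory Num.Theory.
Local Open Scope ring_scope.

(** Write [G] for the matrix inside the Frobenius norm.  Transposing its [i]-th
row gives exactly [H i] ([Hvec_row]), so stacking the vectors [H i] gives a
column [h] with [h^T h = ||G||_F^2], and since the diagonal blocks [beta I]
assemble into one scalar matrix, the LMI is the arrow matrix
[[beta I, h], [h^T, beta]].  By a Schur complement argument such a matrix is
positive semidefinite iff [||h|| <= beta] ([psd_arrowP]): the test vector
[(-h, ||h||)] gives one direction when [h] is not 0, and completing
the square gives the other.

For the submatrix claims, index the rows of the LMI by the pairs [(i, k)],
[i < p], [k < q], followed by one last row.  The product of the two arrow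
matrices [[l I, h], [h^T, l]] has rows indexed by pairs [(i, k)] with [i <= p],
[k <= q]; keep those with [i < p] and [k < q], and the last one [(p, q)].  The
entries selected are [l_s l_t] on the diagonal, [h_s i * h_t k] in the last row
and column, and 0 elsewhere.  The row selection is increasing both for the
Kronecker and for the Tracy-Singh ordering ([lmi_sub_kron],
[lmi_sub_tracy_singh]).  It remains to linearize products of two affine
polynomials: linearization sends [x_i x_j] type monomials to the entries of the
symmetric matrix [W = [[X, S], [S^T, Z]]], hence it sends
[(a.w + c) (b.w + d)] to [a^T W b + d a.w + c b.w + c d]
([linearize_affineM]), which specializes to [beta_lin] and to the entries of
[Hvec] ([linearize_llE], [linearize_hhE]). *)

Lemma addmxE (V : nmodType) m n (A B : 'M[V]_(m, n)) i j :
  (A + B) i j = A i j + B i j.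
Proof. by rewrite mxE. Qed.

Lemma scalemxE (R : pzRingType) m n (a : R) (A : 'M[R]_(m, n)) i j :
  (a *: A) i j = a * A i j.
Proof. by rewrite mxE. Qed.

(** * Semidefiniteness of arrow matrices *)

Section ArrowMatrix.
Variables (R : rcfType) (N : nat).
Implicit Types (h u : 'cV[R]_N) (beta : R).

Lemma dotmx_ge0 h : 0 <= (h^T *m h) 0 0.
Proof. by rewrite mxE sumr_ge0 // => i _; rewrite mxE -expr2 sqr_ge0. Qed.

Lemma dotmx_eq0 h : (h^T *m h) 0 0 = 0 -> h = 0.
Proof.
rewrite mxE => /psumr_eq0P hh; apply/matrixP => i j; rewrite ord1 [RHS]mxE.
apply/eqP; rewrite -sqrf_eq0 expr2.
have /= := hh _ i isT; rewrite mxE => -> // k _.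
by rewrite mxE -expr2 sqr_ge0.
Qed.

Lemma dotmxC u h : (h^T *m u) 0 0 = (u^T *m h) 0 0.
Proof. by rewrite -[u in LHS]trmxK -trmx_mul mxE. Qed.

Lemma arrow_quad_form beta h u (t : 'cV[R]_1) :
  ((col_mx u t)^T *m block_mx beta%:M h h^T beta%:M *m col_mx u t) 0 0
  = beta * (u^T *m u) 0 0 + (u^T *m h) 0 0 * t 0 0 *+ 2 + beta * t 0 0 ^+ 2.
Proof.
rewrite tr_col_mx mul_row_block mul_row_col !mulmxDl.
rewrite !mul_mx_scalar -!scalemxAl !(addmxE, scalemxE) -mulmxA.
have tE (B : 'M_1) : (t^T *m B) 0 0 = t 0 0 * B 0 0 by rewrite mxE big_ord1 mxE.
have -> : (u^T *m h *m t) 0 0 = (u^T *m h) 0 0 * t 0 0 by rewrite mxE big_ord1.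
by rewrite !tE [(h^T *m u) 0 0]dotmxC; ring.
Qed.

(** The Schur complement criterion, phrased without division by [beta] so that
it also covers [beta = 0]. *)
Lemma psd_arrowP beta h :
  psdmx (block_mx beta%:M h h^T (beta%:M : 'M_1))
  <-> Num.sqrt ((h^T *m h) 0 0) <= beta.
Proof.
set d := (h^T *m h) 0 0; set r := Num.sqrt d.
have d0 : 0 <= d := dotmx_ge0 h.
have r0 : 0 <= r := sqrtr_ge0 d.
have dE : d = r ^+ 2 by rewrite sqr_sqrtr.
split=> [[_ psd]|rb].
- have [r_eq0|r_neq0] := eqVneq r 0.
    (* With h = 0 the vector (0, 1) reads off beta. *)
    have := psd (col_mx 0 1%:M); rewrite arrow_quad_form trmx0 !mul0mx !mxE.
    by rewrite r_eq0 /= => ?; lra.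
  have r_gt0 : 0 < r by rewrite lt_def r_neq0.
  (* On (-h, r) with r = ||h|| the form takes the value 2 r^2 (beta - r). *)
  have := psd (col_mx (- h) r%:M).
  rewrite arrow_quad_form [(- h)^T]linearN /= !mulNmx mulmxN opprK.
  rewrite [r%:M 0 0]mxE mulr1n [(- (h^T *m h)) 0 0]mxE -/d dE => ineq.
  have : 0 <= (beta - r) * (r ^+ 2 *+ 2) by move: ineq; congr (0 <= _); ring.
  by rewrite pmulr_lge0 ?subr_ge0 // pmulrn_lgt0 // exprn_gt0.
- split; first by rewrite tr_block_mx !tr_scalar_mx trmxK.
  have b0 : 0 <= beta := le_trans r0 rb.
  move=> v; rewrite -[v]vsubmxK; move: (usubmx v) (dsubmx v) => u t.
  rewrite arrow_quad_form.
  have [bE|b_neq0] := eqVneq beta 0.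
    have h0 : h = 0.
      apply: dotmx_eq0; rewrite -/d dE; apply/eqP; rewrite sqrf_eq0.
      by rewrite eq_le r0 andbT -bE.
    have -> : (u^T *m h) 0 0 = 0 by rewrite h0 mulmx0 mxE.
    by rewrite bE !mul0r mul0rn !addr0.
  have b_gt0 : 0 < beta by rewrite lt_def b_neq0.
  (* beta times the form is |beta u + t h|^2 + t^2 (beta^2 - r^2). *)
  rewrite -(pmulr_rge0 _ b_gt0).
  pose w := beta *: u + t 0 0 *: h.
  have wE : (w^T *m w) 0 0 = beta ^+ 2 * (u^T *m u) 0 0
      + beta * t 0 0 * (u^T *m h) 0 0 *+ 2 + t 0 0 ^+ 2 * d.
    rewrite /w [_^T]linearD /= ![(_ *: _)^T]linearZ /= mulmxDl !mulmxDr.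
    rewrite -!scalemxAl -!scalemxAr.
    have -> : h^T *m u = u^T *m h.
      by apply/matrixP => i j; rewrite !ord1 dotmxC.
    by rewrite !(addmxE, scalemxE) -/d; ring.
  have -> : beta * (beta * (u^T *m u) 0 0 + (u^T *m h) 0 0 * t 0 0 *+ 2
                    + beta * t 0 0 ^+ 2)
      = (w^T *m w) 0 0 + t 0 0 ^+ 2 * (beta ^+ 2 - r ^+ 2).
    by rewrite wE dE; ring.
  rewrite addr_ge0 ?dotmx_ge0 // mulr_ge0 ?sqr_ge0 // subr_ge0.
  by rewrite lerXn2r // nnegrE.
Qed.

End ArrowMatrix.

(** * The linear matrix inequality as an arrow matrix *)

Section LMI.
Variables (p q : nat).
Local Notation idx := 'I_(\sum_(i < p) q).

Lemma lmi_mxE (R : pzRingType) (beta : R) (H : 'I_p -> 'cV[R]_q) :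
  lmi_mx beta H = block_mx beta%:M (\mxcol_i H i) (\mxcol_i H i)^T beta%:M.
Proof. by rewrite /lmi_mx mxdiagZ tr_mxcol. Qed.

(** All blocks have size [q], so block indices are read off by Euclidean
division; monotonicity of index maps becomes arithmetic. *)
Lemma sig_lexE (s : idx) :
  (tagnat.sig1 s * q + tagnat.sig2 s)%N = s :> nat.
Proof.
rewrite [RHS]tagnat.rect; congr (_ + _)%N.
rewrite -(big_ord_widen _ (fun=> q)) ?sum_nat_const ?card_ord //.
exact: ltnW.
Qed.

(** The matrix [M] contains the LMI matrix as soon as it has rows [F i k],
increasing in the lexicographic order of [(i, k)], and a later row [L], on
which it has the entries of an arrow matrix. *)
Lemma lmi_submatrix (R : pzRingType) (beta : R) (H : 'I_p -> 'cV[R]_q)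
    (N : nat) (M : 'M[R]_N) (F : 'I_p -> 'I_q -> 'I_N) (L : 'I_N) :
  (forall s s' : idx, (s < s')%N ->
     (F (tagnat.sig1 s) (tagnat.sig2 s) < F (tagnat.sig1 s') (tagnat.sig2 s'))%N) ->
  (forall i k, F i k < L)%N ->
  (forall i k j l, M (F i k) (F j l) = beta *+ ((i == j) && (k == l))) ->
  (forall i k, M (F i k) L = H i k 0) ->
  (forall i k, M L (F i k) = H i k 0) ->
  M L L = beta ->
  is_submatrix (lmi_mx beta H) M.
Proof.
move=> Fmono FL MFF MFL MLF MLL.
pose f (a : 'I_(\sum_(i < p) q + 1)) := match split a with
  | inl s => F (tagnat.sig1 s) (tagnat.sig2 s) | inr _ => L end.
have fl s : f (lshift 1 s) = F (tagnat.sig1 s) (tagnat.sig2 s).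
  by rewrite /f (unsplitK (inl s)).
have fr s : f (rshift _ s) = L by rewrite /f (unsplitK (inr s)).
have fmono : {homo f : a b / (a < b)%N}.
  move=> a b; case: (split_ordP a) => s ->; case: (split_ordP b) => s' ->.
  - by rewrite !fl; apply: Fmono.
  - by rewrite fl fr => _; apply: FL.
  - by rewrite ltnNge /= ltnW // ltn_addr.
  - by rewrite !ord1 ltnn.
exists f, f; split => //; rewrite lmi_mxE; apply/matrixP => a b.
rewrite [RHS]mxE; case: (split_ordP a) => s ->; case: (split_ordP b) => s' ->.
- rewrite block_mxEul !fl MFF mxE; congr (_ *+ nat_of_bool _).
  apply/eqP/andP => [-> //|[/eqP e1 /eqP e2]].
  by apply: val_inj; rewrite /= -(sig_lexE s) e1 e2 sig_lexE.
- by rewrite block_mxEur fl fr MFL mxE [s']ord1.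
- by rewrite block_mxEdl fl fr MLF !mxE [s]ord1.
- by rewrite block_mxEdr !fr MLL !ord1 mxE.
Qed.

End LMI.

Section Frobenius.
Variables (R : rcfType) (p q : nat).

Lemma frobenius_lmi (G : 'M[R]_(p, q)) (H : 'I_p -> 'cV[R]_q) (beta : R) :
  (forall i, H i = (row i G)^T) ->
  frobenius_norm G <= beta <-> psdmx (lmi_mx beta H).
Proof.
move=> HG; rewrite lmi_mxE psd_arrowP /frobenius_norm.
suff -> : ((\mxcol_i H i)^T *m \mxcol_i H i) 0 0
          = \sum_i \sum_j G i j ^+ 2 by [].
rewrite tr_mxcol mul_mxrow_mxcol summxE; apply: eq_bigr => i _.
by rewrite HG mxE; apply: eq_bigr => j _; rewrite !mxE expr2.
Qed.

End Frobenius.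

(** * Linearization of a product of affine polynomials *)

Section LinearizeProduct.
Variables (R : realType) (n m : nat).
Variables (x : 'cV[R]_n) (z : 'cV[R]_m).
Variables (X : 'M[R]_n) (S : 'M[R]_(n, m)) (Z : 'M[R]_m).
Local Notation lin := (linearize x z X S Z).
Local Notation w := (col_mx x z).
Local Notation W := (block_mx X S S^T Z).

Lemma linearize_is_linear : linear_for *%R lin.
Proof.
move=> a P Q; rewrite /linearize !mcoeffD !mcoeffZ.
have -> : \sum_(i < n + m) (a *: P + Q)@_U_(i) * w i 0
  = a * (\sum_(i < n + m) P@_U_(i) * w i 0) + \sum_(i < n + m) Q@_U_(i) * w i 0.
  rewrite mulr_sumr -big_split; apply: eq_bigr => i _ /=.
  by rewrite mcoeffD mcoeffZ mulrDl mulrA.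
have -> : \sum_(i < n + m) \sum_(j < n + m | (i <= j)%N)
              (a *: P + Q)@_(U_(i) + U_(j)) * W i j
  = a * (\sum_(i < n + m) \sum_(j < n + m | (i <= j)%N)
              P@_(U_(i) + U_(j)) * W i j)
    + \sum_(i < n + m) \sum_(j < n + m | (i <= j)%N)
              Q@_(U_(i) + U_(j)) * W i j.
  rewrite mulr_sumr -big_split; apply: eq_bigr => i _ /=.
  rewrite mulr_sumr -big_split; apply: eq_bigr => j _ /=.
  by rewrite mcoeffD mcoeffZ mulrDl mulrA.
ring.
Qed.

HB.instance Definition _ :=
  GRing.isLinear.Build R {mpoly R[n + m]} R *%R lin linearize_is_linear.

Lemma linearizeZ a P : lin (a *: P) = a * lin P.
Proof. exact: scalarZ. Qed.

Lemma linearizeC c : lin c%:MP = c.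
Proof.
rewrite /linearize mcoeffC eqxx mulr1 big1 => [|i _]; last first.
  by rewrite mcoeffC -mdeg_eq0 mdeg1 mulr0 mul0r.
rewrite big1 ?addr0 // => i _; rewrite big1 // => j _.
by rewrite mcoeffC -mdeg_eq0 mdegD !mdeg1 mulr0 mul0r.
Qed.

Lemma linearizeX k : lin 'X_k = w k 0.
Proof.
rewrite /linearize mcoeffX -mdeg_eq0 mdeg1 add0r.
rewrite (bigD1 k) //= mcoeffXU eqxx mul1r big1 => [|i ik]; last first.
  by rewrite mcoeffXU eq_sym (negPf ik) mul0r.
rewrite big1 ?addr0 // => i _; rewrite big1 // => j _.
rewrite mcoeffX; case: eqP => [/(congr1 mdeg)|]; last by rewrite mul0r.
by rewrite mdegD !mdeg1.
Qed.

(** Ordering the two variables makes quadratic monomials unambiguous; hence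
exactly one term of the double sum in [linearize] reads a given one. *)
Lemma mnm_U2_eq (N : nat) (i j a b : 'I_N) : (i <= j)%N -> (a <= b)%N ->
  (U_(i) + U_(j) == U_(a) + U_(b) :> 'X_{1..N})%MM = (a == i) && (b == j).
Proof.
move=> ij ab; apply/eqP/andP => [/mnmP E|[/eqP-> /eqP->] //].
have {}E k : ((i == k) + (j == k) = (a == k) + (b == k))%N.
  by have := E k; rewrite !mnmDE !mnm1E.
suff : (a = i) /\ (b = j) by case=> -> ->.
have := E i; have := E j; rewrite !eqxx.
case: (eqVneq a i) => [<-|ai]; case: (eqVneq b j) => [<-|bj] //=.
- by case: (eqVneq a j) => [<-|_]; case: (eqVneq j a).
- by case: (eqVneq b i) => [<-|_]; case: (eqVneq i b).
case: (eqVneq a j) => [aj|_]; case: (eqVneq b i) => [bi|_] //=;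
  try by case: (eqVneq i j); case: (eqVneq j i).
(* What remains is a = j and b = i: the two orderings force i = j. *)
move=> _ _; have ii : i = j by apply/val_inj/eqP; rewrite eqn_leq ij -aj -bi.
by rewrite aj ii eqxx in ai.
Qed.

Hypotheses (hX : X^T = X) (hZ : Z^T = Z).

Lemma W_sym i j : W i j = W j i.
Proof.
have WT : W^T = W by rewrite tr_block_mx trmxK hX hZ.
by rewrite -[in LHS]WT mxE.
Qed.

(** Symmetry of [W] is what makes the value independent of the order of the two
factors, [linearize] reading only the entries of [W] on or above the diagonal. *)
Lemma linearizeXX k l : lin ('X_k * 'X_l) = W k l.
Proof.
wlog kl : k l / (k <= l)%N => [hw|].
  by case: (leqP k l) => [/hw //|/ltnW/hw]; rewrite mulrC W_sym.
rewrite -mpolyXD /linearize mcoeffX -mdeg_eq0 mdegD !mdeg1 add0r.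
rewrite big1 => [|i _]; last first.
  rewrite mcoeffX; case: eqP => [/(congr1 mdeg)|]; last by rewrite mul0r.
  by rewrite mdegD !mdeg1.
rewrite add0r (bigD1 k) //= (bigD1 l) //= mcoeffX eqxx mul1r.
rewrite big1 => [|j /andP[kj jl]]; last first.
  by rewrite mcoeffX mnm_U2_eq // (negPf jl) andbF mul0r.
rewrite big1 ?addr0 // => i ik; rewrite big1 // => j ij.
by rewrite mcoeffX mnm_U2_eq // (negPf ik) mul0r.
Qed.

Definition affine_poly (a : 'cV[R]_(n + m)) (c : R) : {mpoly R[n + m]} :=
  \sum_k a k 0 *: 'X_k + c%:MP.

Lemma linearize_linear_form (a : 'cV[R]_(n + m)) :
  lin (\sum_k a k 0 *: 'X_k) = (a^T *m w) 0 0.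
Proof.
rewrite linear_sum /= mxE; apply: eq_bigr => k _.
by rewrite linearizeZ linearizeX [a^T _ _]mxE.
Qed.

(** Linearization is bilinear on pairs of affine polynomials, so its values on
products of two monomials of degree at most one determine it there. *)
Lemma linearize_affineM a b c d :
  lin (affine_poly a c * affine_poly b d)
  = (a^T *m W *m b) 0 0 + d * (a^T *m w) 0 0 + c * (b^T *m w) 0 0 + c * d.
Proof.
rewrite /affine_poly mulrDl !mulrDr -mpolyCM.
rewrite ![_ * d%:MP]mulrC !mul_mpolyC !linearD /= !linearizeZ linearizeC.
rewrite !linearize_linear_form !addrA.
congr (_ + _ + _ + _).
rewrite mulr_suml linear_sum /= -mulmxA mxE; apply: eq_bigr => k _.
rewrite mulr_sumr linear_sum /= [a^T _ _]mxE [(_ *m b) _ _]mxE mulr_sumr.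
apply: eq_bigr => l _.
by rewrite -scalerAl -scalerAr !linearizeZ linearizeXX; ring.
Qed.

Lemma lpoly_affine zeta eta theta :
  lpoly zeta eta theta = affine_poly (col_mx zeta eta) theta.
Proof.
rewrite /lpoly /affine_poly big_split_ord /=; congr (_ + _ + _).
  by rewrite mxE; apply: eq_bigr => k _; rewrite col_mxEu !mxE mul_mpolyC.
by rewrite mxE; apply: eq_bigr => k _; rewrite col_mxEd !mxE mul_mpolyC.
Qed.

Lemma hpoly_affine p (C : 'M[R]_(p, n)) xi i :
  hpoly m C xi i 0 = affine_poly (col_mx (row i C)^T 0) (xi i 0).
Proof.
rewrite /hpoly /affine_poly big_split_ord /= 2![in LHS]mxE; congr (_ + _).
  rewrite [X in _ + X]big1 ?addr0 => [|k _]; last by rewrite col_mxEd mxE scale0r.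
  by apply: eq_bigr => k _; rewrite col_mxEu !mxE mul_mpolyC.
by rewrite !mxE.
Qed.

Lemma linearize_llE zetas zetat etas etat thetas thetat :
  lin (lpoly zetas etas thetas * lpoly zetat etat thetat)
  = beta_lin zetas zetat etas etat thetas thetat x z X S Z.
Proof.
rewrite !lpoly_affine linearize_affineM /beta_lin !tr_col_mx.
rewrite mul_row_block !mul_row_col !mulmxDl.
have -> : etas^T *m S^T *m zetat = zetat^T *m S *m etas.
  rewrite [RHS](_ : _ = (zetat^T *m S *m etas)^T); first
    by rewrite !trmx_mul trmxK mulmxA.
  by apply/matrixP => i j; rewrite !ord1 [RHS]mxE.
rewrite !linearD /= !linearZ /= !mulmxDl -!scalemxAl.
by rewrite !(addmxE, scalemxE); ring.
Qed.

Variables (p q : nat) (Cs : 'M[R]_(p, n)) (xis : 'cV[R]_p).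
Variables (Ct : 'M[R]_(q, n)) (xit : 'cV[R]_q).

Lemma Hvec_row i : Hvec Cs xis Ct xit x X i
  = (row i (Cs *m X *m Ct^T + Cs *m x *m xit^T + xis *m x^T *m Ct^T
            + xis *m xit^T))^T.
Proof.
have mul11 (v : 'cV[R]_q) (B : 'M[R]_1) : v *m B^T = B 0 0 *: v.
  by rewrite -mul_mx_scalar [B in LHS]mx11_scalar tr_scalar_mx.
have rxis : row i xis 0 0 = xis i 0 by rewrite mxE.
have tr_rowD (A B : 'M[R]_(p, q)) :
    (row i (A + B))^T = (row i A)^T + (row i B)^T by rewrite !linearD.
rewrite /Hvec !tr_rowD !row_mul [X in X + _ = _]addrAC; congr (_ + _ + _ + _).
- by rewrite !trmx_mul trmxK hX mulmxA.
- by rewrite trmx_mul trmxK mul11.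
- by rewrite !trmx_mul !trmxK mulmxA mul11 rxis.
- by rewrite trmx_mul trmxK mul11 rxis.
Qed.

Lemma linearize_hhE i k :
  lin (hpoly m Cs xis i 0 * hpoly m Ct xit k 0)
  = Hvec Cs xis Ct xit x X i k 0.
Proof.
have entry (A : 'cV[R]_q) : A k 0 = row k A 0 0 by rewrite mxE.
rewrite !hpoly_affine linearize_affineM !tr_col_mx.
rewrite mul_row_block !mul_row_col !trmx0 !mul0mx !mulmx0 !addr0 !trmxK.
rewrite /Hvec !(addmxE, scalemxE) [(Ct *m X *m _) k 0]entry [(Ct *m x) k 0]entry.
rewrite !row_mul.
have -> : (row k Ct *m X *m (row i Cs)^T) 0 0
          = (row i Cs *m X *m (row k Ct)^T) 0 0.
  have tr11 (B : 'M[R]_1) : B 0 0 = B^T 0 0 by rewrite mxE.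
  by rewrite tr11 !trmx_mul trmxK hX mulmxA.
by ring.
Qed.

End LinearizeProduct.

(** * The two products contain the linear matrix inequality *)

Section SubmatrixEmbeddings.
Variables (R : realType) (n m p q : nat).
Variables (x : 'cV[R]_n) (z : 'cV[R]_m).
Variables (X : 'M[R]_n) (S : 'M[R]_(n, m)) (Z : 'M[R]_m).
Local Notation lin := (linearize x z X S Z).
Variables (ls lt : {mpoly R[n + m]}).
Variables (hs : 'cV[{mpoly R[n + m]}]_p) (ht : 'cV[{mpoly R[n + m]}]_q).
Variables (beta : R) (H : 'I_p -> 'cV[R]_q).
Hypothesis lin_ll : lin (ls * lt) = beta.
Hypothesis lin_hh : forall i k, lin (hs i 0 * ht k 0) = H i k 0.

Lemma lin_diag i j k l :
  lin ((ls%:M : 'M_p) i j * (lt%:M : 'M_q) k l)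
  = beta *+ ((i == j) && (k == l)).
Proof.
rewrite !mxE; case: eqP => _; last by rewrite mul0r linear0.
by case: eqP => _; rewrite ?mulr0 ?linear0 // lin_ll.
Qed.

(** Row [(i, k)] of the LMI is row [i * q + k], and row [i * (q + 1) + k] of the
Kronecker product: the index increases by [i], itself monotone in the row. *)
Lemma lmi_sub_kron :
  is_submatrix (lmi_mx beta H) (map_mx lin (soc_mx ls hs *t soc_mx lt ht)).
Proof.
pose F (i : 'I_p) (k : 'I_q) : 'I_((p + 1) * (q + 1)) :=
  mxtens_index (lshift 1 i, lshift 1 k).
pose L : 'I_((p + 1) * (q + 1)) := mxtens_index (rshift p 0, rshift q 0).
apply: (@lmi_submatrix _ _ _ _ _ _ _ F L).
- move=> s s' ss' /=.
  have le1 : (tagnat.sig1 s <= tagnat.sig1 s')%N.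
    by apply: tagnat.le_sig1; rewrite leEord ltnW.
  rewrite !mulnDr !muln1 -!addnA ![(tagnat.sig1 _ + _)%N]addnC !addnA !sig_lexE.
  by rewrite -addSn leq_add.
- move=> i k /=; rewrite !addn0 -addnS leq_add // ?leq_mul2r ?(ltnW (ltn_ord i)) ?orbT //.
- move=> i k j l; rewrite mxE tensmxE !block_mxEul; exact: lin_diag.
- by move=> i k; rewrite mxE tensmxE !block_mxEur lin_hh.
- by move=> i k; rewrite mxE tensmxE !block_mxEdl ![_^T _ _]mxE lin_hh.
- by rewrite mxE tensmxE !block_mxEdr ![_%:M _ _]mxE lin_ll.
Qed.

(** Grouping the blocks puts the kept rows [(i, k)] first and in their original
positions, and the last row last. *)
Lemma lmi_sub_tracy_singh :
  is_submatrix (lmi_mx beta H)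
    (map_mx lin (tracy_singh (soc_mx ls hs) (soc_mx lt ht))).
Proof.
pose F (i : 'I_p) (k : 'I_q) : 'I_((p * q + p * 1) + (1 * q + 1 * 1)) :=
  lshift _ (lshift _ (mxtens_index (i, k))).
pose L : 'I_((p * q + p * 1) + (1 * q + 1 * 1)) :=
  rshift _ (rshift _ (mxtens_index (0, 0))).
rewrite /tracy_singh /tens_blocks /soc_mx !block_mxKul !block_mxKur
  !block_mxKdl !block_mxKdr.
apply: (@lmi_submatrix _ _ _ _ _ _ _ F L).
- by move=> s s' ss' /=; rewrite !sig_lexE.
- move=> i k; apply: (@leq_trans (p * q)); first exact: (ltn_ord (mxtens_index (i, k))).
  by rewrite /= -addnA leq_addr.
- by move=> i k j l; rewrite mxE !block_mxEul tensmxE; exact: lin_diag.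
- by move=> i k; rewrite mxE !block_mxEur tensmxE lin_hh.
- by move=> i k; rewrite mxE !block_mxEdl tensmxE ![_^T _ _]mxE lin_hh.
- by rewrite mxE !block_mxEdr tensmxE ![_%:M _ _]mxE lin_ll.
Qed.

End SubmatrixEmbeddings.

Theorem mainTheorem10 (R : realType) (n m p q : nat)
    (hp : (1 <= p)%N) (hq : (1 <= q)%N)
    (Cs : 'M[R]_(p, n)) (xis : 'cV[R]_p)
    (Ct : 'M[R]_(q, n)) (xit : 'cV[R]_q)
    (zetas zetat : 'cV[R]_n) (etas etat : 'cV[R]_m) (thetas thetat : R)
    (x : 'cV[R]_n) (z : 'cV[R]_m)
    (X : 'M[R]_n) (S : 'M[R]_(n, m)) (Z : 'M[R]_m)
    (hX : X^T = X) (hZ : Z^T = Z) :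
  let H := Hvec Cs xis Ct xit x X in
  let Ls := soc_mx (lpoly zetas etas thetas) (hpoly m Cs xis) in
  let Lt := soc_mx (lpoly zetat etat thetat) (hpoly m Ct xit) in
  let lin := linearize x z X S Z in
  let beta_st := beta_lin zetas zetat etas etat thetas thetat x z X S Z in
  (forall beta : R,
     frobenius_norm (Cs *m X *m Ct^T + Cs *m x *m xit^T
                     + xis *m x^T *m Ct^T + xis *m xit^T) <= beta
     <-> psdmx (lmi_mx beta H))
  /\ is_submatrix (lmi_mx beta_st H) (map_mx lin (Ls *t Lt))
  /\ is_submatrix (lmi_mx beta_st H) (map_mx lin (tracy_singh Ls Lt)).
Proof.
move=> H Ls Lt lin beta_st.
have ll := linearize_llE x z S hX hZ zetas zetat etas etat thetas thetat.
have hh := linearize_hhE x z S hX hZ Cs xis Ct xit.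
split; first by move=> beta; apply: frobenius_lmi => i; exact: Hvec_row.
by split; [exact: lmi_sub_kron|exact: lmi_sub_tracy_singh].
Qed.
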